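(* Let $\tau\in\mathbf{C}$ satisfy $-\frac12<\Re(\tau)\le\frac12$, $\Im(\tau)>0$, $|\tau|\ge 1$, and $\Re(\tau)\ge 0$ if $|\tau|=1$. For every fixed $\alpha\in(0,\infty)$ the limit $$\widetilde{E}_2^{(\alpha)}=\lim_{K\to\infty}\sum_{|m|\le\lfloor\alpha K\rfloor}\ \sum_{|n|\le K}\frac{1}{(m+n\tau)^2}$$ exists. Furthermore, writing $\widetilde{E}_2^{(\alpha)}=\widetilde{E}_2+\Delta(\alpha,\tau)$ with $\widetilde{E}_2=\widetilde{E}_2^{(1)}$, one has $$\Delta(\alpha,\tau)=-\frac{4i}{\tau}\left(\arctan(i\tau)-\arctan\left(\frac{i\tau}{\alpha}\right)\right).$$
   Context: In the sums $m,n$ are integers and the term $m=n=0$ is omitted; $\lfloor x\rfloor$ is the greatest integer less than or equal to $x$. Thus $\widetilde{E}_2=\lim_{K\to\infty}\sum_{|m|,|n|\le K}(m+n\tau)^{-2}$. Here $\arctan$ is the principal branch of the complex arctangent (cuts along the imaginary axis where $|\Im|\ge1$); the arguments $i\tau$ and $i\tau/\alpha$ have negative real part. *)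

(* Defs.v *)
From Stdlib Require Import Reals ZArith Lra Lia.
From Coquelicot Require Import Coquelicot.

Open Scope R_scope.

(* Sum of [f m] over the integers [m] with [|m| <= M]. *)
Definition sum_abs_le (f : Z -> C) (M : nat) : C :=
  sum_n (fun k : nat => f (Z.of_nat k - Z.of_nat M)%Z) (2 * M).

Definition lattice_term (tau : C) (m n : Z) : C :=
  if ((m =? 0) && (n =? 0))%Z%bool then 0%C
  else (/ (IZR m + IZR n * tau) ^ 2)%C.

(* For [alpha > 0] the floor is nonnegative, so [Z.to_nat] loses nothing. *)
Definition E2_partial (alpha : R) (tau : C) (K : nat) : C :=
  sum_abs_le
    (fun m : Z => sum_abs_le (fun n : Z => lattice_term tau m n) K)
    (Z.to_nat (Zfloor (alpha * INR K))).

Definition is_E2 (alpha : R) (tau l : C) : Prop :=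
  filterlim (E2_partial alpha tau) eventually (locally l).

(* Principal argument, in (-PI, PI]; the value at 0 is irrelevant. *)
Definition Carg (z : C) : R :=
  if Rlt_dec (Im z) 0 then - acos (Re z / Cmod z) else acos (Re z / Cmod z).

Definition Clog (z : C) : C := (ln (Cmod z), Carg z).

(* Analytic off the two cuts [i y], [|y| >= 1]: there [1 + i z] or [1 - i z]
   is a nonpositive real, and nowhere else. *)
Definition Catan (z : C) : C :=
  ((Clog (1 + Ci * z) - Clog (1 - Ci * z)) / (2 * Ci))%C.

Lemma Carg_spec (z : C) : z <> 0%C ->
  - PI < Carg z <= PI /\
  z = (Cmod z * cos (Carg z), Cmod z * sin (Carg z)).
Proof.
intros hz.
assert (hm : 0 < Cmod z) by now apply Cmod_gt_0.
assert (hsq : Cmod z * Cmod z = Re z * Re z + Im z * Im z).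
{ unfold Cmod. rewrite sqrt_sqrt; [|nra]. unfold Re, Im. ring. }
set (c := Re z / Cmod z).
assert (hRe : Re z = Cmod z * c) by (unfold c; field; lra).
assert (hc : -1 <= c <= 1).
{ assert (c * c <= 1); [|nra].
  apply Rmult_le_reg_l with (Cmod z * Cmod z); nra. }
assert (hs : Rabs (Im z) = Cmod z * sqrt (1 - Rsqr c)).
{ rewrite <- sqrt_Rsqr_abs.
  replace (Rsqr (Im z)) with (Rsqr (Cmod z) * (1 - Rsqr c))
    by (unfold Rsqr; rewrite hRe in hsq; nra).
  rewrite sqrt_mult; [|apply Rle_0_sqr|unfold Rsqr; nra].
  now rewrite sqrt_Rsqr by lra. }
assert (hb := acos_bound c).
assert (hC : cos (acos c) = c) by now apply cos_acos.
assert (hS : sin (acos c) = sqrt (1 - Rsqr c)) by now apply sin_acos.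
unfold Carg; fold c; destruct (Rlt_dec (Im z) 0) as [h|h].
- split.
  + split; [|lra].
    destruct (Req_dec (acos c) PI) as [e|e]; [exfalso|lra].
    rewrite e, sin_PI in hS. rewrite <- hS, Rmult_0_r in hs.
    rewrite Rabs_left in hs; lra.
  + rewrite cos_neg, sin_neg, hC, hS. rewrite Rabs_left in hs by lra.
    destruct z as [x y]; unfold Re, Im in *; simpl in *. f_equal; lra.
- split; [split; [generalize PI_RGT_0; lra|lra]|].
  rewrite hC, hS. rewrite Rabs_right in hs by lra.
  destruct z as [x y]; unfold Re, Im in *; simpl in *. f_equal; lra.
Qed.

Lemma Catan_real (x : R) : Catan x = atan x.
Proof.
assert (Hp : forall y, Carg (1, y) = atan y).
{ intros y.
  assert (hne : ((1, y) : C) <> 0%C) by (intros e; injection e; lra).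
  destruct (Carg_spec _ hne) as [hb he].
  assert (hm : 0 < Cmod (1, y)) by now apply Cmod_gt_0.
  set (t := Carg (1, y)) in *.
  injection he as h1 h2.
  assert (hc : 0 < cos t) by nra.
  assert (ht : - PI / 2 < t < PI / 2).
  { split.
    - destruct (Rlt_dec (- PI / 2) t); [lra|].
      assert (cos (- t) <= 0) by (apply cos_le_0; lra).
      rewrite cos_neg in *; lra.
    - destruct (Rlt_dec t (PI / 2)); [lra|].
      assert (cos t <= 0) by (apply cos_le_0; lra). lra. }
  transitivity (atan (tan t)); [rewrite atan_tan; lra|f_equal].
  unfold tan. apply Rmult_eq_reg_r with (cos t); [|lra].
  unfold Rdiv. rewrite Rmult_assoc, Rinv_l by lra.
  rewrite h2 at 1.
  rewrite (Rmult_comm (Cmod _)), Rmult_assoc, <- h1; ring. }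
assert (e1 : (1 + Ci * x)%C = (1, x))
  by (unfold Cplus, Cmult, Ci, RtoC; simpl; f_equal; ring).
assert (e2 : (1 - Ci * x)%C = (1, - x))
  by (unfold Cminus, Copp, Cplus, Cmult, Ci, RtoC; simpl; f_equal; ring).
unfold Catan, Clog. rewrite e1, e2, !Hp, atan_opp.
replace (Cmod (1, - x)) with (Cmod (1, x))
  by (unfold Cmod; simpl; f_equal; ring).
unfold Cdiv, Cminus, Copp, Cplus, Cmult, Cinv, Ci, RtoC; simpl.
f_equal; field.
Qed.

(* Main.v *)
(* A primitive of 1/(x + y tau)^2 with respect to x and y is
   -(1/tau) Log (x + y tau).  Subtracting from each term with n <> 0 the
   corresponding double difference over the unit cell centred at (m, n) leaves
   O(|m + n tau|^-4) (the first-order error vanishes by symmetry of the cell), and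
   these corrected terms, together with the row n = 0, form an absolutely
   convergent double series, whose sum does not depend on alpha.  The double
   differences telescope to values of Log at the corners of the rectangle.  After
   rescaling these depend only on the ratios (K + 1/2)/(M + 1/2) and
   (1/2)/(M + 1/2), where M = floor (alpha K), which tend to 1/alpha and 0. *)

Require Import Defs.
From Stdlib Require Import Reals ZArith Lra Lia.
From Coquelicot Require Import Coquelicot.
Open Scope R_scope.

(** * The complex exponential and functional equations of the principal logarithm *)

Definition Cexp (z : C) : C := (exp (Re z) * cos (Im z), exp (Re z) * sin (Im z)).

Lemma Cexp_plus (z w : C) : Cexp (z + w) = (Cexp z * Cexp w)%C.
Proof.
unfold Cexp, Cmult; simpl.
rewrite exp_plus, cos_plus, sin_plus; f_equal; unfold Re, Im; ring.
Qed.

Lemma Cmod_polar (r t : R) : 0 <= r -> Cmod (r * cos t, r * sin t) = r.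
Proof.
intros hr; unfold Cmod; simpl.
replace (r * cos t * (r * cos t * 1) + r * sin t * (r * sin t * 1))
  with (r * r * (Rsqr (sin t) + Rsqr (cos t))) by (unfold Rsqr; ring).
rewrite sin2_cos2, Rmult_1_r. now apply sqrt_square.
Qed.

Lemma Cexp_Clog (z : C) : z <> 0%C -> Cexp (Clog z) = z.
Proof.
intros hz. destruct (Carg_spec z hz) as [_ h].
unfold Cexp, Clog; simpl. rewrite exp_ln by now apply Cmod_gt_0.
now symmetry.
Qed.

Lemma Clog_Cexp (z : C) : - PI < Im z <= PI -> Clog (Cexp z) = z.
Proof.
destruct z as [a t]; simpl; intros ht.
unfold Cexp, Clog; simpl.
assert (ha := exp_pos a).
rewrite Cmod_polar, ln_exp by lra. f_equal.
unfold Carg; simpl. rewrite Cmod_polar by lra.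
replace (exp a * cos t / exp a) with (cos t) by (field; lra).
destruct (Rlt_dec (exp a * sin t) 0) as [h|h].
- assert (t < 0).
  { destruct (Rlt_dec t 0) as [|n]; [easy|].
    assert (0 <= sin t) by (apply sin_ge_0; lra). nra. }
  rewrite <- cos_neg, acos_cos by lra. ring.
- assert (0 <= t).
  { destruct (Rlt_dec t 0) as [n|]; [|lra].
    assert (0 < sin (- t)) by (apply sin_gt_0; lra).
    rewrite sin_neg in *. nra. }
  apply acos_cos; lra.
Qed.

Lemma Clog_mult (z w : C) : z <> 0%C -> w <> 0%C ->
  - PI < Carg z + Carg w <= PI -> Clog (z * w) = (Clog z + Clog w)%C.
Proof.
intros hz hw h.
rewrite <- (Cexp_Clog z hz) at 1. rewrite <- (Cexp_Clog w hw) at 1.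
rewrite <- Cexp_plus. now apply Clog_Cexp.
Qed.

Lemma Carg_Im_pos (z : C) : 0 < Im z -> 0 < Carg z < PI.
Proof.
intros h.
assert (hz : z <> 0%C) by (intros e; rewrite e in h; simpl in h; lra).
destruct (Carg_spec z hz) as [hb e].
assert (hm : 0 < Cmod z) by now apply Cmod_gt_0.
assert (e2 : Im z = Cmod z * sin (Carg z)) by (rewrite e at 1; easy).
assert (hs : 0 < sin (Carg z)) by nra.
split.
- destruct (Rlt_dec 0 (Carg z)) as [|n]; [easy|].
  assert (0 <= sin (- Carg z)) by (apply sin_ge_0; lra).
  rewrite sin_neg in *; lra.
- destruct (Req_dec (Carg z) PI) as [k|]; [|lra].
  rewrite k, sin_PI in hs; lra.
Qed.

Lemma Carg_Re_pos (z : C) : 0 < Re z -> Carg z = atan (Im z / Re z).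
Proof.
intros h.
assert (hz : z <> 0%C) by (intros e; rewrite e in h; simpl in h; lra).
destruct (Carg_spec z hz) as [hb e].
assert (hm : 0 < Cmod z) by now apply Cmod_gt_0.
set (t := Carg z) in *.
assert (e1 : Re z = Cmod z * cos t) by (rewrite e at 1; easy).
assert (e2 : Im z = Cmod z * sin t) by (rewrite e at 1; easy).
assert (hc : 0 < cos t) by nra.
assert (ht : - PI / 2 < t < PI / 2).
{ split.
  - destruct (Rlt_dec (- PI / 2) t); [lra|].
    assert (cos (- t) <= 0) by (apply cos_le_0; lra).
    rewrite cos_neg in *; lra.
  - destruct (Rlt_dec t (PI / 2)); [lra|].
    assert (cos t <= 0) by (apply cos_le_0; lra). lra. }
rewrite <- (atan_tan t) by lra. f_equal.
unfold tan. rewrite e1, e2. field; lra.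
Qed.

Lemma Carg_opp_Ci : Carg (- Ci) = - (PI / 2).
Proof.
unfold Carg; simpl. rewrite Cmod_opp, Cmod_Ci. destruct (Rlt_dec (- (1)) 0); [|lra].
replace (- 0 / 1) with 0 by field. now rewrite acos_0.
Qed.

Lemma RtoC_neq_0 (r : R) : r <> 0 -> RtoC r <> 0%C.
Proof. intros h e; apply h; now injection e. Qed.

Lemma Im_pos_neq_0 (z : C) : 0 < Im z -> z <> 0%C.
Proof. intros h e; rewrite e in h; simpl in h; lra. Qed.

Lemma Clog_scal (r : R) (z : C) : 0 < r -> z <> 0%C ->
  Clog (r * z) = (ln r + Clog z)%C.
Proof.
intros hr hz.
assert (ha : Carg r = 0).
{ rewrite Carg_Re_pos by easy; simpl.
  unfold Rdiv; rewrite Rmult_0_l; apply atan_0. }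
rewrite Clog_mult; [|apply RtoC_neq_0; lra|easy|].
- f_equal. unfold Clog. rewrite ha, Cmod_R, Rabs_right by lra. easy.
- rewrite ha, Rplus_0_l. now apply Carg_spec.
Qed.

Lemma Ci_neq_0 : Ci <> 0%C.
Proof. intros e; injection e; lra. Qed.

(** Multiplication by [- Ci] turns the upper half plane into the right one, where the argument is an
    arctangent. The arguments [- PI / 2] and [Carg z] add up to less than [PI / 2] in absolute
    value, so no branch jump occurs. *)
Lemma Clog_Im_pos (z : C) : 0 < Im z ->
  Clog z = (Clog (- Ci * z) + (0, (PI / 2)%R))%C.
Proof.
intros h. assert (hz := Im_pos_neq_0 z h). assert (hb := Carg_Im_pos z h).
rewrite Clog_mult; [|intros e; injection e; lra|easy|].
- unfold Clog at 2. rewrite Carg_opp_Ci, Cmod_opp, Cmod_Ci, ln_1.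
  unfold Clog, Cplus; simpl; f_equal; ring.
- rewrite Carg_opp_Ci. lra.
Qed.

(** This form needs no case distinction on [Re z] and shows that the argument decreases along
    horizontal lines. *)
Lemma Carg_Im_pos_atan (z : C) : 0 < Im z -> Carg z = PI / 2 - atan (Re z / Im z).
Proof.
intros h. assert (e := Clog_Im_pos z h).
apply (f_equal Im) in e; simpl in e. rewrite e.
assert (e1 : (- Ci * z)%C = (Im z, - Re z))
  by (unfold Cmult, Copp, Re, Im; simpl; f_equal; ring).
rewrite e1, Carg_Re_pos by easy. simpl.
replace (- Re z / Im z) with (- (Re z / Im z)) by (field; lra).
rewrite atan_opp; ring.
Qed.

(** The argument of [z] lies in (0, PI), so after subtracting [PI] it is still in the principal
    range. *)
Lemma Clog_opp (z : C) : 0 < Im z -> Clog (- z) = (Clog z - (0, PI))%C.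
Proof.
intros h. assert (hb := Carg_Im_pos z h).
rewrite <- (Clog_Cexp (Clog z - (0, PI))) by (simpl; lra).
f_equal. rewrite <- (Cexp_Clog z) at 1 by now apply Im_pos_neq_0.
unfold Cexp; simpl.
replace (ln (Cmod z) + - 0) with (ln (Cmod z)) by ring.
rewrite cos_plus, sin_plus, cos_neg, sin_neg, cos_PI, sin_PI.
unfold Copp; simpl; f_equal; ring.
Qed.

Lemma Im_plus_R (z : C) (d : R) : Im (z + d) = Im z.
Proof. unfold Im; simpl; ring. Qed.

(* Along a horizontal segment in the upper half plane the argument changes by
   less than [PI], so the imaginary part of the left-hand side stays in
   (-PI, PI) and the principal branch is the right one. *)
Lemma Clog_cross_ratio (p q : C) (d : R) :
  0 < d -> 0 < Im p -> 0 < Im q ->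
  (Clog (p + d) - Clog p - (Clog (q + d) - Clog q))%C
    = Clog ((p + d) * q / (p * (q + d)))%C.
Proof.
intros hd hp hq.
set (D := (Clog (p + d) - Clog p - (Clog (q + d) - Clog q))%C).
assert (hpd : 0 < Im (p + d)) by now rewrite Im_plus_R.
assert (hqd : 0 < Im (q + d)) by now rewrite Im_plus_R.
assert (key : forall z, 0 < Im z -> - PI < Im (Clog (z + d) - Clog z) < 0).
{ intros z hz. assert (hzd : 0 < Im (z + d)) by now rewrite Im_plus_R.
  assert (h1 := Carg_Im_pos _ hz). assert (h2 := Carg_Im_pos _ hzd).
  assert (h3 := Carg_Im_pos_atan _ hz). assert (h4 := Carg_Im_pos_atan _ hzd).
  rewrite Im_plus_R in h4.
  assert (atan (Re z / Im z) < atan (Re (z + d) / Im z)).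
  { apply atan_increasing.
    apply Rmult_lt_compat_r; [now apply Rinv_0_lt_compat|unfold Re; simpl; lra]. }
  change (- PI < Carg (z + d) - Carg z < 0). lra. }
assert (h : - PI < Im D <= PI).
{ assert (h1 := key p hp). assert (h2 := key q hq). unfold D.
  unfold Im in *; simpl in *; lra. }
rewrite <- (Clog_Cexp D h). f_equal.
assert (e : (Cexp D * (Cexp (Clog p) * Cexp (Clog (q + d))) =
   Cexp (Clog (p + d)) * Cexp (Clog q))%C).
{ rewrite <- !Cexp_plus. f_equal. unfold D. ring. }
apply Im_pos_neq_0 in hp, hq, hpd, hqd.
rewrite !Cexp_Clog in e by easy. rewrite <- e. field. split; easy.
Qed.

(** * Second-order remainder of the logarithm at 1 *)

Lemma ln_le_sub1 (x : R) : 0 < x -> ln x <= x - 1.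
Proof.
intros hx. destruct (Req_dec x 1) as [->|n]; [rewrite ln_1; lra|].
assert (h := exp_ineq1 (ln x)). rewrite exp_ln in h by easy.
enough (ln x <> 0) by (specialize (h H); lra).
now apply ln_neq_0.
Qed.

(** The lower bound is ln x <= x - 1 applied to 1/(1 + t); the factor 4 bounds 1/(1 + t) for t >=
    -3/4. *)
Lemma ln_1p_bounds (t : R) : - 3 / 4 <= t -> - 4 * t ^ 2 <= ln (1 + t) - t <= 0.
Proof.
intros ht. split.
- assert (h := ln_le_sub1 (/ (1 + t)) ltac:(apply Rinv_0_lt_compat; lra)).
  rewrite ln_Rinv in h by lra.
  enough (/ (1 + t) - 1 + t <= 4 * t ^ 2) by lra.
  replace (/ (1 + t) - 1 + t) with (t ^ 2 * / (1 + t)) by (field; lra).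
  assert (/ (1 + t) <= 4).
  { rewrite <- (Rinv_inv 4). apply Rinv_le_contravar; lra. }
  nra.
- assert (h := ln_le_sub1 (1 + t)). lra.
Qed.

(** Mean value theorem: the derivative of atan x - x at c is -c^2/(1 + c^2), of absolute value at
    most |c| <= |v|. *)
Lemma atan_sub_bound (v : R) : Rabs (atan v - v) <= v ^ 2.
Proof.
destruct (MVT_gen (fun x => atan x - x) 0 v (fun x => / (1 + Rsqr x) - 1)) as [c [hc e]].
- intros x _. auto_derive; [easy|]. unfold Rsqr; field; nra.
- intros x _. apply continuity_pt_filterlim.
  apply (continuous_minus atan (fun x => x)); [apply continuous_atan|apply continuous_id].
- rewrite atan_0 in e. replace (atan v - v) with (atan v - v - (0 - 0)) by ring.
  rewrite e. replace (v - 0) with v by ring.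
  assert (hcv : Rabs c <= Rabs v).
  { revert hc. unfold Rmin, Rmax, Rabs.
    destruct (Rle_dec 0 v); destruct (Rcase_abs c); destruct (Rcase_abs v); lra. }
  assert (hr : Rabs (/ (1 + Rsqr c) - 1) <= Rabs c).
  { replace (/ (1 + Rsqr c) - 1) with (- (c * (c * / (1 + Rsqr c))))
      by (unfold Rsqr; field; nra).
    rewrite Rabs_Ropp, !Rabs_mult.
    rewrite <- (Rmult_1_r (Rabs c)) at 3. apply Rmult_le_compat_l; [apply Rabs_pos|].
    assert (hp : 0 < 1 + Rsqr c) by (assert (h := Rle_0_sqr c); lra).
    rewrite Rabs_inv, (Rabs_pos_eq (1 + _)) by lra.
    apply Rmult_le_reg_r with (1 + Rsqr c); [easy|].
    rewrite Rmult_assoc, Rinv_l by lra.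
    assert (h := Rsqr_abs c). unfold Rsqr in *. nra. }
  rewrite Rabs_mult, <- (pow2_abs v).
  assert (h := Rabs_pos c). assert (h' := Rabs_pos v). nra.
Qed.

Lemma Clog_taylor (w : C) : Cmod w <= 1 / 2 ->
  Cmod (Clog (1 + w) - w) <= 24 * Cmod w ^ 2.
Proof.
intros hw. destruct w as [x y].
assert (hm := Cmod2_alt (x, y)). simpl Re in hm; simpl Im in hm.
set (s := Cmod (x, y)) in *.
assert (hs : 0 <= s) by apply Cmod_ge_0.
assert (hx : - (1 / 2) <= x <= 1 / 2) by (split; nra).
(* Here 1 + t = |1 + w|^2, which is at least 1/4 because |w| <= 1/2. The real part of the logarithm
   is half of ln (1 + t). *)
set (t := 2 * x + x ^ 2 + y ^ 2).
assert (ht : - 3 / 4 <= t) by (unfold t; nra).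
assert (hl := ln_1p_bounds t ht).
assert (e1 : Re (Clog (1 + (x, y)) - (x, y)) = / 2 * ln (1 + t) - x).
{ simpl. set (r := Cmod (1 + (x, y))).
  assert (hr : r * r = 1 + t).
  { replace (r * r) with (r ^ 2) by ring. unfold r. rewrite Cmod2_alt.
    simpl; unfold t; ring. }
  assert (h0 : 0 < r).
  { assert (0 <= r) by apply Cmod_ge_0. nra. }
  rewrite <- hr, ln_mult by easy. field. }
assert (e2 : Im (Clog (1 + (x, y)) - (x, y)) = atan (y / (1 + x)) - y).
{ simpl. rewrite Carg_Re_pos by (simpl; lra). simpl. rewrite Rplus_0_l. ring. }
assert (hR : Rabs (Re (Clog (1 + (x, y)) - (x, y))) <= 16 * s ^ 2).
{ rewrite e1. apply Rabs_le.
  assert (ht2 : t ^ 2 <= 8 * s ^ 2).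
  { replace t with (2 * x + s ^ 2) by (unfold t; lra).
    assert (s ^ 2 * s ^ 2 <= / 4 * s ^ 2) by (apply Rmult_le_compat_r; nra).
    nra. }
  assert (ht3 : t = 2 * x + s ^ 2) by (unfold t; lra).
  split; nra. }
assert (hI : Rabs (Im (Clog (1 + (x, y)) - (x, y))) <= 6 * s ^ 2).
{ rewrite e2. set (v := y / (1 + x)).
  assert (hi : 0 < / (1 + x) <= 2).
  { split; [apply Rinv_0_lt_compat; lra|].
    rewrite <- (Rinv_inv 2). apply Rinv_le_contravar; lra. }
  replace (atan v - y) with ((atan v - v) + (v - y)) by ring.
  eapply Rle_trans; [apply Rabs_triang|].
  assert (h1 := atan_sub_bound v).
  assert (h2 : v ^ 2 <= 4 * s ^ 2).
  { unfold v, Rdiv. rewrite Rpow_mult_distr.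
    assert ((/ (1 + x)) ^ 2 <= 4) by nra. nra. }
  assert (h3 : Rabs (v - y) <= 2 * s ^ 2).
  { replace (v - y) with (- (x * y) * / (1 + x)) by (unfold v; field; lra).
    rewrite Rabs_mult, (Rabs_pos_eq (/ _)) by lra.
    assert (Rabs (- (x * y)) <= s ^ 2) by (apply Rabs_le; nra).
    assert (h := Rabs_pos (- (x * y))). nra. }
  lra. }
eapply Rle_trans; [apply Cmod_2Rmax|].
change (fst ?z) with (Re z); change (snd ?z) with (Im z).
(* The modulus is at most sqrt 2 times the larger component, whence 24 = (3/2) * 16. *)
assert (hq : sqrt 2 <= 3 / 2).
{ rewrite <- (sqrt_square (3 / 2)) by lra. apply sqrt_le_1; lra. }
assert (0 <= sqrt 2) by apply sqrt_pos.
assert (0 <= s ^ 2) by nra.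
assert (hmx : Rmax (Rabs (Re (Clog (1 + (x, y)) - (x, y))))
             (Rabs (Im (Clog (1 + (x, y)) - (x, y)))) <= 16 * s ^ 2)
  by (apply Rmax_lub; lra).
assert (0 <= Rmax (Rabs (Re (Clog (1 + (x, y)) - (x, y))))
             (Rabs (Im (Clog (1 + (x, y)) - (x, y)))))
  by (eapply Rle_trans; [apply Rabs_pos|apply Rmax_l]).
apply Rle_trans with (3 / 2 * (16 * s ^ 2)); [|lra].
now apply Rmult_le_compat.
Qed.

(** * Sums over symmetric ranges of integers and over rectangles *)

Ltac to_C := change (@plus _) with Cplus;
  try match goal with |- ?a = ?b => change (@eq C a b) end.

Lemma sum_n_first {G : AbelianMonoid} (a : nat -> G) (n : nat) :
  sum_n a (S n) = plus (a O) (sum_n (fun k => a (S k)) n).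
Proof.
unfold sum_n. rewrite sum_Sn_m by lia. now rewrite <- sum_n_m_S.
Qed.

Lemma sum_n_telescope (f : nat -> C) (n : nat) :
  sum_n (fun k => (f (S k) - f k)%C) n = (f (S n) - f O)%C.
Proof.
induction n as [|n IH]; [now rewrite sum_O|].
rewrite sum_Sn, IH. to_C. ring.
Qed.

(** Contribution of the pair k, -k, with 0 counted once. It turns a symmetric sum over integers into
    an ordinary partial sum over naturals. *)
Definition pm_sum (f : Z -> C) (k : nat) : C :=
  match k with
  | O => f 0%Z
  | S _ => (f (Z.of_nat k) + f (- Z.of_nat k)%Z)%C
  end.

Lemma sum_abs_le_pm_sum (f : Z -> C) (M : nat) :
  sum_abs_le f M = sum_n (pm_sum f) M.
Proof.
induction M as [|M IH]; [unfold sum_abs_le; simpl; now rewrite !sum_O|].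
rewrite sum_Sn, <- IH. unfold sum_abs_le.
replace (2 * S M)%nat with (S (S (2 * M))) by lia.
rewrite sum_Sn, sum_n_first.
to_C. unfold pm_sum.
rewrite (sum_n_ext (fun k => f (Z.of_nat (S k) - Z.of_nat (S M))%Z)
  (fun k => f (Z.of_nat k - Z.of_nat M)%Z)) by (intros k; f_equal; lia).
replace (Z.of_nat (S (S (2 * M))) - Z.of_nat (S M))%Z with (Z.of_nat (S M)) by lia.
replace (Z.of_nat 0 - Z.of_nat (S M))%Z with (- Z.of_nat (S M))%Z by lia.
ring.
Qed.

Definition dsum (h : nat -> nat -> C) (M K : nat) : C :=
  sum_n (fun k => sum_n (h k) K) M.

Lemma pm_sum_sum_n (u : Z -> nat -> C) (K k : nat) :
  pm_sum (fun m => sum_n (u m) K) k = sum_n (fun j => pm_sum (fun m => u m j) k) K.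
Proof.
destruct k as [|k]; [easy|]. symmetry. apply (sum_n_plus (u _) (u _) K).
Qed.

Lemma sum_abs_le_dsum (u : Z -> nat -> C) (M K : nat) :
  sum_abs_le (fun m => sum_n (u m) K) M
    = dsum (fun k j => pm_sum (fun m => u m j) k) M K.
Proof.
rewrite sum_abs_le_pm_sum. apply sum_n_ext; intros k. apply pm_sum_sum_n.
Qed.

Lemma dsum_lin (h g : nat -> nat -> C) (c : C) (M K : nat) :
  dsum (fun k j => (h k j + c * g k j)%C) M K = (dsum h M K + c * dsum g M K)%C.
Proof.
unfold dsum.
rewrite <- (sum_n_mult_l (K := C_Ring) c), <- (sum_n_plus (G := C_Ring)).
apply sum_n_ext; intros k.
rewrite <- (sum_n_mult_l (K := C_Ring) c), <- (sum_n_plus (G := C_Ring)).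
easy.
Qed.

(** * Convergence of double series dominated by a product weight *)

Definition qterm (k : nat) : R := / ((INR k + 1) * (INR k + 2)).

Lemma qterm_pos (k : nat) : 0 < qterm k.
Proof. apply Rinv_0_lt_compat. assert (h := pos_INR k). nra. Qed.

(** The reason for the shape of the weight: it decays like 1/k^2, yet its partial sums and tails are
    explicit. *)
Lemma qterm_telescope (k : nat) : qterm k = / (INR k + 1) - / (INR k + 2).
Proof. unfold qterm. assert (h := pos_INR k). field. lra. Qed.

Lemma sum_n_qterm_le (u : nat -> C) (c : R) (M : nat) :
  (forall k, Cmod (u k) <= c * qterm k) ->
  Cmod (sum_n u M) <= c * (1 - / (INR M + 2)).
Proof.
intros h. induction M as [|M IH].
- rewrite sum_O. eapply Rle_trans; [apply h|]. rewrite qterm_telescope. simpl; lra.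
- rewrite sum_Sn. to_C.
  eapply Rle_trans; [apply Cmod_triangle|].
  specialize (h (S M)). rewrite qterm_telescope in h.
  rewrite S_INR in *. replace (INR M + 1 + 1) with (INR M + 2) in h by ring. lra.
Qed.

Lemma sum_n_qterm_tail (u : nat -> C) (c : R) (N M : nat) :
  (forall k, Cmod (u k) <= c * qterm k) -> (N <= M)%nat ->
  Cmod (sum_n u M - sum_n u N) <= c * / (INR N + 2).
Proof.
intros h hNM.
assert (hc : 0 <= c).
{ assert (h0 := h O). assert (hq := qterm_pos O). assert (h1 := Cmod_ge_0 (u O)). nra. }
enough (Cmod (sum_n u M - sum_n u N) <= c * (/ (INR N + 2) - / (INR M + 2))).
{ assert (0 < / (INR M + 2)) by (apply Rinv_0_lt_compat; assert (p := pos_INR M); lra).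
  nra. }
induction hNM as [|M hNM IH].
- replace (sum_n u N - sum_n u N)%C with (RtoC 0) by ring. rewrite Cmod_0. lra.
- rewrite sum_Sn. to_C.
  replace (sum_n u M + u (S M) - sum_n u N)%C
    with (sum_n u M - sum_n u N + u (S M))%C by ring.
  eapply Rle_trans; [apply Cmod_triangle|].
  specialize (h (S M)). rewrite qterm_telescope in h.
  rewrite S_INR in *. replace (INR M + 1 + 1) with (INR M + 2) in h by ring. lra.
Qed.

(** The N by N square is enlarged to the rectangle one index at a time. Each enlargement costs a
    tail c/(N + 2) in that index, while the weights of the other index sum to at most 1. *)
Lemma dsum_cauchy (h : nat -> nat -> C) (c : R) (N M K : nat) :
  (forall k j, Cmod (h k j) <= c * qterm k * qterm j) ->
  (N <= M)%nat -> (N <= K)%nat ->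
  Cmod (dsum h M K - dsum h N N) <= 2 * c * / (INR N + 2).
Proof.
intros hb hM hK.
assert (hc : 0 <= c).
{ assert (h0 := hb O O). assert (hq := qterm_pos O). assert (h1 := Cmod_ge_0 (h O O)).
  assert (0 < qterm 0 * qterm 0) by nra. nra. }
assert (hr : forall n, 0 < / (INR n + 2)).
{ intros n. apply Rinv_0_lt_compat. assert (p := pos_INR n); lra. }
replace (dsum h M K - dsum h N N)%C
  with ((dsum h M K - dsum h N K) + (dsum h N K - dsum h N N))%C by ring.
eapply Rle_trans; [apply Cmod_triangle|].
assert (h1 : Cmod (dsum h M K - dsum h N K) <= c * / (INR N + 2)).
{ apply sum_n_qterm_tail; [|easy]. intros k.
  eapply Rle_trans; [apply (sum_n_qterm_le (h k) (c * qterm k)); apply hb|].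
  assert (hq := qterm_pos k). specialize (hr K).
  assert (0 <= c * qterm k) by nra. nra. }
assert (h2 : Cmod (dsum h N K - dsum h N N) <= c * / (INR N + 2)).
(* The order of summation is exchanged so that the growing index becomes the outer one. *)
{ unfold dsum. rewrite !(sum_n_switch h). apply sum_n_qterm_tail; [|easy]. intros j.
  eapply Rle_trans.
  - apply (sum_n_qterm_le (fun k => h k j) (c * qterm j)). intros k.
    replace (c * qterm j * qterm k) with (c * qterm k * qterm j) by ring. apply hb.
  - assert (hq := qterm_pos j). specialize (hr N).
    assert (0 <= c * qterm j) by nra. nra. }
lra.
Qed.

(** The limit is taken along the product filter, with both bounds tending to infinity independently.
    One limit therefore serves every relation between them, in particular every alpha. *)
Lemma dsum_converges (h : nat -> nat -> C) (c : R) :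
  (forall k j, Cmod (h k j) <= c * qterm k * qterm j) ->
  exists L : C, filterlim (fun p => dsum h (fst p) (snd p))
    (filter_prod eventually eventually) (@locally C_UniformSpace L).
Proof.
intros hb.
set (F := filtermap (fun p => dsum h (fst p) (snd p)) (filter_prod eventually eventually)).
assert (hF : ProperFilter F) by (apply filtermap_proper_filter; apply _).
exists (C_complete_lim F). intros P [eps hP].
apply (filter_imp (F := F) (@ball C_UniformSpace (C_complete_lim F) eps)); [exact hP|].
apply C_complete_ax1; [exact hF|]. clear P eps hP. intros eps.
destruct (nfloor_ex (Rabs (2 * c / eps)) (Rabs_pos _)) as [N [_ hN]].
exists (dsum h N N).
apply (Filter_prod _ _ _ (fun M => (N <= M)%nat) (fun K => (N <= K)%nat)).
- now exists N.
- now exists N.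
- intros M K hM hK. apply C_NormedModule_mixin_compat1.
  change (Cmod (dsum h M K - dsum h N N) < eps).
  eapply Rle_lt_trans; [now apply dsum_cauchy with (c := c)|].
  assert (he := cond_pos eps). assert (hp := pos_INR N).
  apply Rmult_lt_reg_r with (INR N + 2); [lra|].
  rewrite Rmult_assoc, Rinv_l, Rmult_1_r by lra.
  assert (2 * c / eps < INR N + 2) by (assert (hh := Rle_abs (2 * c / eps)); lra).
  replace (2 * c) with (eps * (2 * c / eps)) by (field; lra). nra.
Qed.

Lemma finite_bound (g : nat -> R) (N : nat) :
  exists B : R, forall k, (k < N)%nat -> g k <= B.
Proof.
induction N as [|N [B hB]]; [exists 0; lia|].
exists (Rmax B (g N)). intros k hk.
destruct (Nat.eq_dec k N) as [->|n]; [apply Rmax_r|].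
eapply Rle_trans; [apply hB; lia|apply Rmax_l].
Qed.

Lemma finite_bound2 (g : nat -> nat -> R) (N K : nat) :
  exists B : R, forall k j, (k < N)%nat -> (j < K)%nat -> g k j <= B.
Proof.
induction N as [|N [B hB]]; [exists 0; lia|].
destruct (finite_bound (g N) K) as [B' hB'].
exists (Rmax B B'). intros k j hk hj.
destruct (Nat.eq_dec k N) as [->|n].
- eapply Rle_trans; [now apply hB'|apply Rmax_r].
- eapply Rle_trans; [apply hB; lia|apply Rmax_l].
Qed.

(** The cell estimate holds only away from the origin; the finitely many terms of the N by N block
    are absorbed by enlarging the constant. *)
Lemma dsum_converges_cofinite (h : nat -> nat -> C) (c : R) (N : nat) :
  (forall k j, (N <= k \/ N <= j)%nat -> Cmod (h k j) <= c * qterm k * qterm j) ->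
  exists L : C, filterlim (fun p => dsum h (fst p) (snd p))
    (filter_prod eventually eventually) (@locally C_UniformSpace L).
Proof.
intros hb.
destruct (finite_bound2 (fun k j => Cmod (h k j) / (qterm k * qterm j)) N N) as [B hB].
apply dsum_converges with (c := Rmax c B). intros k j.
assert (hk := qterm_pos k). assert (hj := qterm_pos j).
assert (hp : 0 < qterm k * qterm j) by now apply Rmult_lt_0_compat.
rewrite Rmult_assoc.
destruct (Nat.le_gt_cases N k) as [h1|h1]; [|destruct (Nat.le_gt_cases N j) as [h2|h2]].
- eapply Rle_trans; [apply hb; now left|]. rewrite Rmult_assoc.
  apply Rmult_le_compat_r; [lra|apply Rmax_l].
- eapply Rle_trans; [apply hb; now right|]. rewrite Rmult_assoc.
  apply Rmult_le_compat_r; [lra|apply Rmax_l].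
- specialize (hB k j h1 h2). simpl in hB.
  replace (Cmod (h k j)) with (Cmod (h k j) / (qterm k * qterm j) * (qterm k * qterm j))
    by (field; lra).
  apply Rmult_le_compat_r; [lra|]. eapply Rle_trans; [exact hB|apply Rmax_r].
Qed.

(** * The cell estimate and the decay of lattice terms *)

(* [strip (m + y tau)] is the integral over [m - 1/2 <= x <= m + 1/2] of the
   derivative [1 / (x + y tau)] of [Clog (x + y tau)]. *)
Definition strip (x : C) : C := (Clog (x + RtoC (1 / 2)) - Clog (x - RtoC (1 / 2)))%C.

(* The increment of [strip] is [Clog (1 - tau / (z ^ 2 - c))] with
   [c = ((1 - tau) / 2) ^ 2]; its first-order term cancels [1 / z ^ 2] up to
   [O (|z| ^ -4)]. *)
Lemma strip_cell (tau z : C) : 0 < Im tau -> Im tau <= Im z ->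
  4 * Cmod tau + 2 * Cmod ((1 - tau) / 2) ^ 2 <= Cmod z ^ 2 ->
  Cmod (/ z ^ 2 + / tau * (strip (z + tau / 2) - strip (z - tau / 2)))
  <= (2 * Cmod ((1 - tau) / 2) ^ 2 + 96 * Cmod tau) / (Cmod z ^ 2) ^ 2.
Proof.
intros ht hz hR.
assert (ht0 := Im_pos_neq_0 tau ht).
assert (hz0 : z <> 0%C) by (apply Im_pos_neq_0; lra).
assert (hm : 0 < Cmod tau) by now apply Cmod_gt_0.
set (c := (((1 - tau) / 2) ^ 2)%C).
assert (hc : Cmod ((1 - tau) / 2) ^ 2 = Cmod c) by (unfold c; now rewrite Cmod_pow).
rewrite hc in *. clear hc.
assert (hc0 := Cmod_ge_0 c).
set (s := Cmod z ^ 2) in *.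
assert (hs : Cmod (z ^ 2) = s) by (unfold s; now rewrite Cmod_pow).
(* The size hypothesis on |z|^2 is used twice: its part 2|c| keeps the denominator above s/2 here,
   and its part 4|tau| gives |w| <= 1/2 below. *)
assert (hden : s / 2 <= Cmod (z ^ 2 - c)).
{ assert (h := Cmod_triangle (z ^ 2 - c) c).
  replace (z ^ 2 - c + c)%C with (z ^ 2)%C in h by ring. lra. }
assert (hd0 : (z ^ 2 - c)%C <> 0%C).
{ intros e. rewrite e, Cmod_0 in hden. lra. }
set (w := (- tau / (z ^ 2 - c))%C).
assert (hw : Cmod w <= 2 * Cmod tau / s).
{ unfold w. rewrite Cmod_div, Cmod_opp by easy.
  replace (2 * Cmod tau / s) with (Cmod tau * / (s / 2)) by (field; lra).
  apply Rmult_le_compat_l; [lra|]. apply Rinv_le_contravar; lra. }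
assert (hw2 : Cmod w <= 1 / 2).
{ eapply Rle_trans; [exact hw|]. apply Rmult_le_reg_r with s; [lra|].
  unfold Rdiv at 1. rewrite Rmult_assoc, Rinv_l by lra. lra. }
assert (htay := Clog_taylor w hw2).
assert (e : (strip (z + tau / 2) - strip (z - tau / 2) = Clog (1 + w))%C).
{ unfold strip.
  set (p := (z + tau / 2 - RtoC (1 / 2))%C). set (q := (z - tau / 2 - RtoC (1 / 2))%C).
  assert (ip : Im p = Im z + Im tau / 2).
  { unfold p, Im, RtoC. simpl. field. }
  assert (iq : Im q = Im z - Im tau / 2).
  { unfold q, Im, RtoC. simpl. field. }
  assert (h1 : 0 < Im (p + 1)) by (rewrite Im_plus_R; lra).
  assert (h2 : 0 < Im (q + 1)) by (rewrite Im_plus_R; lra).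
  assert (h3 : 0 < Im p) by lra. assert (h4 : 0 < Im q) by lra.
  assert (e12 : RtoC (1 / 2) = (1 / 2)%C).
  { unfold Cdiv. rewrite <- RtoC_inv, <- RtoC_mult by lra. easy. }
  replace (z + tau / 2 + RtoC (1 / 2))%C with (p + 1)%C
    by (unfold p; rewrite e12; field; apply RtoC_neq_0; lra).
  replace (z - tau / 2 + RtoC (1 / 2))%C with (q + 1)%C
    by (unfold q; rewrite e12; field; apply RtoC_neq_0; lra).
  rewrite (Clog_cross_ratio p q 1) by lra. f_equal.
  apply Im_pos_neq_0 in h1, h2, h3, h4.
  assert (e2 : (p * (q + 1) = z ^ 2 - c)%C).
  { unfold p, q, c. rewrite e12. field; apply RtoC_neq_0; lra. }
  assert (e3 : ((p + 1) * q = z ^ 2 - c - tau)%C).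
  { unfold p, q, c. rewrite e12. field; apply RtoC_neq_0; lra. }
  rewrite e2, e3. unfold w. field. easy. }
rewrite e.
(* The linear part w/tau equals -1/(z^2 - c), and 1/z^2 - 1/(z^2 - c) = -c/(z^2 (z^2 - c)) is
   already of order |z|^-4. *)
replace (/ z ^ 2 + / tau * Clog (1 + w))%C
  with (- c / (z ^ 2 * (z ^ 2 - c)) + / tau * (Clog (1 + w) - w))%C
  by (unfold w; field; repeat split; easy).
eapply Rle_trans; [apply Cmod_triangle|].
assert (hz2 : (z ^ 2)%C <> 0%C) by (intros e0; rewrite e0, Cmod_0 in hs; lra).
rewrite Cmod_div, Cmod_opp, !Cmod_mult, Cmod_inv, hs by (try apply Cmult_neq_0; easy).
assert (hs0 : 0 < s) by lra.
replace ((2 * Cmod c + 96 * Cmod tau) / s ^ 2)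
  with (Cmod c * / (s * (s / 2)) + / Cmod tau * (24 * (2 * Cmod tau / s) ^ 2))
  by (field; lra).
apply Rplus_le_compat.
- apply Rmult_le_compat_l; [easy|]. apply Rinv_le_contravar; [nra|].
  apply Rmult_le_compat_l; lra.
- apply Rmult_le_compat_l; [left; now apply Rinv_0_lt_compat|].
  eapply Rle_trans; [exact htay|]. apply Rmult_le_compat_l; [lra|].
  apply pow_incr. split; [apply Cmod_ge_0|exact hw].
Qed.

(** In x^2 + 2xy Re(tau) + y^2 |tau|^2 the cross term is at least -(x^2 + y^2)/2, and |tau|^2 >= 1.
    The fundamental domain enters here. *)
Lemma lattice_norm_ge (tau : C) (x y : R) :
  Rabs (Re tau) <= 1 / 2 -> 1 <= Cmod tau ->
  (x ^ 2 + y ^ 2) / 2 <= Cmod (x + y * tau) ^ 2.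
Proof.
intros h1 h2. rewrite Cmod2_alt.
assert (h3 := Cmod2_alt tau).
replace (Re (x + y * tau)) with (x + y * Re tau) by (unfold Re; simpl; ring).
replace (Im (x + y * tau)) with (y * Im tau) by (unfold Im; simpl; ring).
apply Rabs_le_between in h1.
assert (h4 : 1 <= Re tau ^ 2 + Im tau ^ 2) by nra.
assert (h5 : y ^ 2 * 1 <= y ^ 2 * (Re tau ^ 2 + Im tau ^ 2))
  by (apply Rmult_le_compat_l; nra).
assert (h6 : - (x ^ 2 + y ^ 2) / 2 <= 2 * (x * y) * Re tau).
{ assert (hp := pow2_ge_0 (x + y)). assert (hq := pow2_ge_0 (x - y)).
  assert (ha : - (x ^ 2 + y ^ 2) <= 2 * (x * y) <= x ^ 2 + y ^ 2) by lra.
  destruct (Rle_dec 0 (Re tau)); nra. }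
nra.
Qed.

(** Away from the origin both (k + 1)(k + 2)/6 and (j + 1)(j + 2)/6 are at most k^2 + j^2, which
    splits the quartic decay into a product; 36 = 6 * 6. *)
Lemma inv_quartic_le (k j : nat) : (1 <= k \/ 1 <= j)%nat ->
  / (INR k ^ 2 + INR j ^ 2) ^ 2 <= 36 * qterm k * qterm j.
Proof.
intros h.
assert (hk := pos_INR k). assert (hj := pos_INR j).
assert (h1 : 1 <= INR k ^ 2 + INR j ^ 2).
{ destruct h as [h|h]; apply (le_INR 1) in h; simpl in h; nra. }
unfold qterm.
replace (36 * / ((INR k + 1) * (INR k + 2)) * / ((INR j + 1) * (INR j + 2)))
  with (/ ((((INR k + 1) * (INR k + 2)) / 6) * (((INR j + 1) * (INR j + 2)) / 6)))
  by (field; lra).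
apply Rinv_le_contravar.
- apply Rmult_lt_0_compat; nra.
- replace ((INR k ^ 2 + INR j ^ 2) ^ 2)
    with ((INR k ^ 2 + INR j ^ 2) * (INR k ^ 2 + INR j ^ 2)) by ring.
  assert (p1 := pow2_ge_0 (INR k - 1)). assert (p2 := pow2_ge_0 (INR j - 1)).
  assert (p3 := pow2_ge_0 (INR k)). assert (p4 := pow2_ge_0 (INR j)).
  apply Rmult_le_compat; nra.
Qed.

(** * Continuity of the logarithm and limits of corner values *)

Lemma continuous_C_pair {U : UniformSpace} (f g : U -> R) (x : U) :
  continuous f x -> continuous g x ->
  @continuous U C_UniformSpace (fun t => (f t, g t)) x.
Proof.
intros hf hg P [eps hP].
assert (h1 := hf _ (locally_ball (f x) eps)).
assert (h2 := hg _ (locally_ball (g x) eps)).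
unfold filtermap in *. generalize (filter_and _ _ h1 h2). apply filter_imp.
intros t [a b]. apply hP. now split.
Qed.

Lemma continuous_Re (z : C) : @continuous C_UniformSpace R_UniformSpace Re z.
Proof. apply (@continuous_fst R_UniformSpace R_UniformSpace). Qed.

Lemma continuous_Im (z : C) : @continuous C_UniformSpace R_UniformSpace Im z.
Proof. apply (@continuous_snd R_UniformSpace R_UniformSpace). Qed.

(** Near such a point the case split in [Carg] can be replaced by a single arctangent. The upper and
    lower half planes are then reached by a rotation and a negation. *)
Lemma continuous_Clog_Re_pos (z : C) : 0 < Re z ->
  @continuous C_UniformSpace C_UniformSpace Clog z.
Proof.
intros h.
assert (hz : z <> 0%C) by (intros e; rewrite e in h; simpl in h; lra).
apply (continuous_ext_loc (T := C_UniformSpace) (U := C_UniformSpace) _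
  (fun w => (ln (Cmod w), atan (Im w / Re w)))).
- apply (filter_imp (fun w : C => 0 < Re w)).
  + intros w hw. unfold Clog. now rewrite Carg_Re_pos.
  + apply (continuous_Re z). now apply open_gt.
- apply continuous_C_pair.
  + apply (continuous_comp (U := C_UniformSpace) Cmod ln).
    * apply (filterlim_norm (V := C_NormedModule) z).
    * apply continuous_ln. now apply Cmod_gt_0.
  + apply (continuous_comp (U := C_UniformSpace) (fun w => Im w / Re w) atan);
      [|apply continuous_atan].
    apply (continuous_mult (U := C_UniformSpace) (K := R_AbsRing) Im (fun w => / Re w));
      [apply continuous_Im|].
    apply (continuous_comp (U := C_UniformSpace) Re Rinv); [apply continuous_Re|].
    apply continuous_Rinv. lra.
Qed.

Lemma continuous_C_plus_cst (f : C -> C) (c z : C) :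
  @continuous C_UniformSpace C_UniformSpace f z ->
  @continuous C_UniformSpace C_UniformSpace (fun w => (f w + c)%C) z.
Proof.
intros h. apply (continuous_plus (V := C_NormedModule) f (fun _ => c)); [exact h|].
apply continuous_const.
Qed.

Lemma continuous_Clog_Im_pos (z : C) : 0 < Im z ->
  @continuous C_UniformSpace C_UniformSpace Clog z.
Proof.
intros h.
apply (continuous_ext_loc (T := C_UniformSpace) (U := C_UniformSpace) _
  (fun w => (Clog (- Ci * w) + (0, (PI / 2)%R))%C)).
- apply (filter_imp (fun w : C => 0 < Im w)).
  + intros w hw. now rewrite (Clog_Im_pos w).
  + apply (continuous_Im z). now apply open_gt.
- apply continuous_C_plus_cst.
  apply (continuous_comp (U := C_UniformSpace) (V := C_UniformSpace)
    (W := C_UniformSpace) (fun w => (- Ci * w)%C) Clog).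
  + apply (filterlim_scal_r (V := C_NormedModule)).
  + apply continuous_Clog_Re_pos.
    replace (Re (- Ci * z)) with (Im z) by (unfold Re, Im; simpl; ring). exact h.
Qed.

Lemma continuous_Clog_Im_neg (z : C) : Im z < 0 ->
  @continuous C_UniformSpace C_UniformSpace Clog z.
Proof.
intros h.
apply (continuous_ext_loc (T := C_UniformSpace) (U := C_UniformSpace) _
  (fun w => (Clog (- (1) * w) + - (0, PI))%C)).
- apply (filter_imp (fun w : C => Im w < 0)).
  + intros w hw. replace (- (1) * w)%C with (- w)%C by ring.
    replace (Clog w) with (Clog (- - w)) by (f_equal; ring).
    rewrite (Clog_opp (- w)); [easy|unfold Im in *; simpl; lra].
  + apply (continuous_Im z (fun x => x < 0)). now apply open_lt.
- apply continuous_C_plus_cst.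
  apply (continuous_comp (U := C_UniformSpace) (V := C_UniformSpace)
    (W := C_UniformSpace) (fun w => (- (1) * w)%C) Clog).
  + apply (filterlim_scal_r (V := C_NormedModule)).
  + apply continuous_Clog_Im_pos.
    replace (Im (- (1) * z)) with (- Im z) by (unfold Re, Im; simpl; ring). lra.
Qed.

Lemma filterlim_C_plus {T : Type} {F : (T -> Prop) -> Prop} {FF : Filter F}
    (f g : T -> C) (a b : C) :
  filterlim f F (@locally C_UniformSpace a) ->
  filterlim g F (@locally C_UniformSpace b) ->
  filterlim (fun t => (f t + g t)%C) F (@locally C_UniformSpace (a + b)%C).
Proof.
intros hf hg.
exact (filterlim_comp_2 f g Cplus hf hg (filterlim_plus (V := C_NormedModule) a b)).
Qed.

Lemma filterlim_C_scal {T : Type} {F : (T -> Prop) -> Prop} {FF : Filter F}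
    (c : C) (f : T -> C) (a : C) :
  filterlim f F (@locally C_UniformSpace a) ->
  filterlim (fun t => (c * f t)%C) F (@locally C_UniformSpace (c * a)%C).
Proof.
intros hf.
exact (filterlim_comp _ _ _ f (fun z => (c * z)%C) _ _ _ hf
  (filterlim_scal_r (V := C_NormedModule) c a)).
Qed.

(* Unlike [Clog (w + 1) - Clog (w - 1)], this is continuous at [w = 0]. *)
Definition log_ratio (w : C) : C := (Clog (1 + w) - Clog (1 - w))%C.

Lemma Catan_log_ratio (w : C) : Catan (Ci * w) = (- log_ratio w / (2 * Ci))%C.
Proof.
unfold Catan, log_ratio.
assert (e : (Ci * (Ci * w) = - w)%C).
{ destruct w as [x y]. unfold Cmult, Copp, Ci; simpl; f_equal; ring. }
rewrite e. replace (1 + - w)%C with (1 - w)%C by ring.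
replace (1 - - w)%C with (1 + w)%C by ring.
unfold Cdiv. ring.
Qed.

Lemma filterlim_log_ratio {T : Type} {F : (T -> Prop) -> Prop} {FF : Filter F}
    (tau : C) (r : T -> R) (l : R) :
  0 < Im tau -> 0 <= l -> filterlim r F (locally l) ->
  filterlim (fun t => log_ratio (r t * tau)) F
    (@locally C_UniformSpace (log_ratio (l * tau))).
Proof.
intros ht hl hr.
assert (hw : forall c : C, filterlim (fun t => (1 + c * (r t * tau))%C) F
    (@locally C_UniformSpace (1 + c * (l * tau))%C)).
{ intros c. apply filterlim_C_plus; [apply filterlim_const|].
  apply filterlim_C_scal.
  apply (filterlim_ext (fun t => (tau * r t)%C)); [intros t; ring|].
  rewrite (Cmult_comm l). apply filterlim_C_scal.
  apply (filterlim_comp _ _ _ r RtoC _ _ _ hr).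
  apply (continuous_C_pair (fun x => x) (fun _ => 0)).
  - apply continuous_id.
  - apply continuous_const. }
(* Both logarithms are handled at once with c = 1 or -1. If l = 0 the point is 1; otherwise it lies
   strictly in the upper or lower half plane, off the cut. *)
assert (hc : forall c : C, (c = 1%C \/ c = (- (1))%C) ->
  @continuous C_UniformSpace C_UniformSpace Clog (1 + c * (l * tau))%C).
{ intros c hc.
  destruct (Req_dec l 0) as [e|e].
  - apply continuous_Clog_Re_pos. rewrite e.
    replace (1 + c * (0 * tau))%C with (RtoC 1) by ring. simpl; lra.
  - assert (hi : 0 < l * Im tau) by (apply Rmult_lt_0_compat; lra).
    destruct hc as [-> | ->]; [apply continuous_Clog_Im_pos|apply continuous_Clog_Im_neg];
      unfold Im in *; simpl; lra. }
unfold log_ratio.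
apply (filterlim_ext (fun t => (Clog (1 + 1 * (r t * tau))
  + - (1) * Clog (1 + - (1) * (r t * tau)))%C)).
{ intros t. replace (1 + 1 * (r t * tau))%C with (1 + r t * tau)%C by ring.
  replace (1 + - (1) * (r t * tau))%C with (1 - r t * tau)%C by ring. ring. }
replace (Clog (1 + l * tau) - Clog (1 - l * tau))%C
  with (Clog (1 + 1 * (l * tau)) + - (1) * Clog (1 + - (1) * (l * tau)))%C.
2:{ replace (1 + 1 * (l * tau))%C with (1 + l * tau)%C by ring.
  replace (1 + - (1) * (l * tau))%C with (1 - l * tau)%C by ring. ring. }
apply filterlim_C_plus; [|apply filterlim_C_scal].
- apply (filterlim_comp _ _ _ _ Clog _ _ _ (hw 1%C)). apply hc; now left.
- apply (filterlim_comp _ _ _ _ Clog _ _ _ (hw (- (1))%C)). apply hc; now right.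
Qed.

(** * Telescoping of the double differences to corner values *)

Lemma RtoC_half : RtoC (1 / 2) = (1 / 2)%C.
Proof. unfold Cdiv. rewrite <- RtoC_inv, <- RtoC_mult by lra. easy. Qed.

(** The row j = 0 receives no correction: its cells straddle the real axis, which carries the cut
    and the singularity of [Clog]. *)
Definition strip_diff (tau : C) (m : Z) (j : nat) : C :=
  match j with
  | O => 0%C
  | S _ => (strip (IZR m + INR j * tau + tau / 2) - strip (IZR m + INR j * tau - tau / 2))%C
  end.

Lemma sum_n_strip_diff (tau : C) (m : Z) (K : nat) :
  sum_n (strip_diff tau m) K
    = (strip (IZR m + (INR K + 1 / 2)%R * tau) - strip (IZR m + (1 / 2)%R * tau))%C.
Proof.
assert (h2 : RtoC 2 <> 0%C) by (apply RtoC_neq_0; lra).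
induction K as [|K IH].
- rewrite sum_O. simpl INR. rewrite Rplus_0_l. simpl. ring.
- rewrite sum_Sn, IH. to_C. unfold strip_diff. rewrite S_INR.
  replace (IZR m + (INR K + 1)%R * tau + tau / 2)%C
    with (IZR m + (INR K + 1 + 1 / 2)%R * tau)%C
    by (rewrite !RtoC_plus, RtoC_half; field; easy).
  replace (IZR m + (INR K + 1)%R * tau - tau / 2)%C
    with (IZR m + (INR K + 1 / 2)%R * tau)%C
    by (rewrite !RtoC_plus, RtoC_half; field; easy).
  ring.
Qed.

(** The sum telescopes to Clog (x + X) - Clog (x - X) with X = M + 1/2. Factoring out X > 0 cancels
    ln X, and passing from -(1 - w) to 1 - w produces the constant -i PI. *)
Lemma sum_abs_le_strip (x : C) (M : nat) : 0 < Im x ->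
  sum_abs_le (fun m => strip (IZR m + x)) M
    = (log_ratio (/ (INR M + 1 / 2)%R * x) + (0%R, - PI)%R)%C.
Proof.
intros hx. assert (n2 : RtoC 2 <> 0%C) by (apply RtoC_neq_0; lra).
set (X := INR M + 1 / 2). assert (hX : 0 < X) by (unfold X; assert (h := pos_INR M); lra).
set (g := fun k : nat => Clog (x + (INR k - X)%R)).
assert (e : sum_abs_le (fun m => strip (IZR m + x)) M = (g (S (2 * M)) - g O)%C).
{ rewrite <- sum_n_telescope. apply sum_n_ext. intros k. unfold strip, g.
  rewrite minus_IZR, <- !INR_IZR_INZ, S_INR.
  replace ((INR k - INR M)%R + x + RtoC (1 / 2))%C with (x + (INR k + 1 - X)%R)%C.
  - replace ((INR k - INR M)%R + x - RtoC (1 / 2))%C with (x + (INR k - X)%R)%C; [easy|].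
    unfold X. rewrite !RtoC_minus, !RtoC_plus, RtoC_half. field; easy.
  - unfold X. rewrite !RtoC_minus, !RtoC_plus, RtoC_half; field; easy. }
rewrite e. unfold g.
replace (x + (INR (S (2 * M)) - X)%R)%C with (X * (1 + / X * x))%C.
2:{ rewrite S_INR, mult_INR. simpl (INR 2).
  replace ((1 + 1) * INR M + 1 - X) with X by (unfold X; field).
  field. apply RtoC_neq_0; lra. }
replace (x + (INR 0 - X)%R)%C with (X * - (1 - / X * x))%C.
2:{ simpl INR. rewrite RtoC_minus. field. apply RtoC_neq_0; lra. }
set (w := (/ X * x)%C).
assert (hw : 0 < Im w).
{ unfold w. rewrite <- RtoC_inv by lra.
  replace (Im (RtoC (/ X)%R * x)) with (/ X * Im x) by (unfold Im; simpl; ring).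
  apply Rmult_lt_0_compat; [now apply Rinv_0_lt_compat|easy]. }
clearbody w. assert (h1 : 0 < Im (1 + w)) by (unfold Im in *; simpl; lra).
assert (h2 : 0 < Im (- (1 - w))) by (unfold Im in *; simpl; lra).
rewrite !Clog_scal by (try apply Im_pos_neq_0; easy).
assert (e2 := Clog_opp _ h2).
replace (- - (1 - w))%C with (1 - w)%C in e2 by ring.
unfold log_ratio. rewrite e2.
replace ((0, - PI)%R : C) with (- ((0, PI)%R : C))%C
  by (unfold Copp; simpl; f_equal; ring).
ring.
Qed.

Lemma sum_abs_le_plus_scal (f g : Z -> C) (c : C) (M : nat) :
  sum_abs_le (fun m => (f m + c * g m)%C) M = (sum_abs_le f M + c * sum_abs_le g M)%C.
Proof.
unfold sum_abs_le.
rewrite <- (sum_n_mult_l (K := C_Ring) c), <- (sum_n_plus (G := C_Ring)).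
easy.
Qed.

(** Each column telescopes to the heights K + 1/2 and 1/2; in the difference of the two horizontal
    sums the constants -i PI cancel. *)
Lemma dsum_strip_diff (tau : C) (M K : nat) : 0 < Im tau ->
  dsum (fun k j => pm_sum (fun m => strip_diff tau m j) k) M K
    = (log_ratio (((INR K + 1 / 2) / (INR M + 1 / 2))%R * tau)
       - log_ratio (((1 / 2) / (INR M + 1 / 2))%R * tau))%C.
Proof.
intros ht.
rewrite <- (sum_abs_le_dsum (strip_diff tau)).
assert (hK := pos_INR K). assert (hM := pos_INR M).
assert (hX : RtoC (INR M + 1 / 2) <> 0%C) by (apply RtoC_neq_0; lra).
transitivity (sum_abs_le (fun m => (strip (IZR m + (INR K + 1 / 2)%R * tau)
  + - (1) * strip (IZR m + (1 / 2)%R * tau))%C) M).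
{ apply sum_n_ext. intros k. rewrite sum_n_strip_diff. to_C; ring. }
rewrite sum_abs_le_plus_scal, !sum_abs_le_strip.
- replace (/ (INR M + 1 / 2)%R * ((INR K + 1 / 2)%R * tau))%C
    with (((INR K + 1 / 2) / (INR M + 1 / 2))%R * tau)%C
    by (unfold Rdiv at 1; rewrite RtoC_mult, RtoC_inv by lra; ring).
  replace (/ (INR M + 1 / 2)%R * ((1 / 2)%R * tau))%C
    with (((1 / 2) / (INR M + 1 / 2))%R * tau)%C
    by (unfold Rdiv at 1; rewrite RtoC_mult, RtoC_inv by lra; ring).
  ring.
- replace (Im ((1 / 2)%R * tau)) with (1 / 2 * Im tau) by (unfold Im; simpl; ring). lra.
- replace (Im ((INR K + 1 / 2)%R * tau)) with ((INR K + 1 / 2) * Im tau)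
    by (unfold Im; simpl; ring).
  apply Rmult_lt_0_compat; lra.
Qed.

(** * Lattice terms grouped by sign changes, and bounds on the corrected terms *)

Lemma lattice_term_opp (tau : C) (m n : Z) :
  lattice_term tau (- m) (- n) = lattice_term tau m n.
Proof.
unfold lattice_term.
replace (- m =? 0)%Z with (m =? 0)%Z by (destruct m; easy).
replace (- n =? 0)%Z with (n =? 0)%Z by (destruct n; easy).
destruct (_ && _)%bool; [easy|]. f_equal.
rewrite !opp_IZR, !RtoC_opp. ring.
Qed.

(* Sum of the lattice terms over the orbit of [(k, j)] under the sign changes
   of both coordinates. *)
Definition lattice_orbit (tau : C) (k j : nat) : C :=
  pm_sum (fun m => pm_sum (lattice_term tau m) j) k.

(** Central symmetry folds the rows n < 0 onto the rows n > 0, so the logarithm is needed only in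
    the upper half plane. This is why the correction carries 2/tau and not 1/tau. *)
Lemma lattice_orbit_S (tau : C) (k i : nat) :
  lattice_orbit tau k (S i)
    = (2 * pm_sum (fun m => lattice_term tau m (Z.of_nat (S i))) k)%C.
Proof.
unfold lattice_orbit, pm_sum.
destruct k as [|k].
- rewrite <- (lattice_term_opp tau 0 (- _)). rewrite Z.opp_involutive. simpl Z.opp. ring.
- rewrite <- (lattice_term_opp tau (- _) (- _)), !Z.opp_involutive.
  rewrite <- (lattice_term_opp tau (Z.of_nat (S k)) (- _)), !Z.opp_involutive. ring.
Qed.

Lemma pm_sum_bound (f : Z -> C) (k : nat) (B : R) :
  Cmod (f (Z.of_nat k)) <= B -> Cmod (f (- Z.of_nat k)%Z) <= B ->
  Cmod (pm_sum f k) <= 2 * B.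
Proof.
intros h1 h2. assert (h0 := Cmod_ge_0 (f (Z.of_nat k))).
destruct k as [|k]; unfold pm_sum.
- simpl in *. lra.
- eapply Rle_trans; [apply Cmod_triangle|]. lra.
Qed.

Lemma pm_sum_plus_scal (f g : Z -> C) (c : C) (k : nat) :
  (pm_sum f k + c * pm_sum g k)%C = pm_sum (fun m => (f m + c * g m)%C) k.
Proof. destruct k; unfold pm_sum; ring. Qed.

Lemma lattice_orbit_0_bound (tau : C) (k : nat) :
  Cmod (lattice_orbit tau k 0) <= 24 * qterm k * qterm 0.
Proof.
assert (hq := qterm_pos k).
assert (e0 : qterm 0 = 1 / 2) by (unfold qterm; simpl; field).
rewrite e0. unfold lattice_orbit.
destruct k as [|k]; [change (Cmod (RtoC 0) <= 24 * qterm 0 * (1 / 2)); rewrite Cmod_0; lra|].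
assert (hk := pos_INR k).
assert (h : Cmod (lattice_term tau (Z.of_nat (S k)) 0) <= 6 * qterm (S k)).
{ unfold lattice_term. replace (Z.of_nat (S k) =? 0)%Z with false by easy.
  simpl andb. cbv iota. rewrite <- INR_IZR_INZ.
  replace (INR (S k) + 0 * tau)%C with (RtoC (INR (S k))) by ring.
  rewrite Cmod_inv, Cmod_pow, Cmod_R, pow2_abs.
  2:{ apply Cpow_nz, RtoC_neq_0. rewrite S_INR; lra. }
  unfold qterm. rewrite S_INR.
  replace (6 * / ((INR k + 1 + 1) * (INR k + 1 + 2)))
    with (/ ((INR k + 1 + 1) * (INR k + 1 + 2) / 6)) by (field; lra).
  apply Rinv_le_contravar; nra. }
eapply Rle_trans.
- apply (pm_sum_bound _ (S k) (6 * qterm (S k))); [exact h|].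
  change (Cmod (lattice_term tau (- Z.of_nat (S k)) (- 0)) <= 6 * qterm (S k)).
  rewrite lattice_term_opp. exact h.
- lra.
Qed.

(** The threshold is twice that of [strip_cell], as |z|^2 is only known to be at least half of k^2 +
    j^2. The constant is 576 = 2 * 2 * 4 * 36: the folding of rows, the pair of columns, the square
    of that half, and [inv_quartic_le]. *)
Lemma lattice_orbit_S_bound (tau : C) (k i N : nat) :
  Rabs (Re tau) <= 1 / 2 -> 1 <= Cmod tau -> 0 < Im tau ->
  8 * Cmod tau + 4 * Cmod ((1 - tau) / 2) ^ 2 <= INR N ->
  (N <= k \/ N <= S i)%nat ->
  Cmod (lattice_orbit tau k (S i)
    + 2 / tau * pm_sum (fun m => strip_diff tau m (S i)) k)
  <= 576 * (2 * Cmod ((1 - tau) / 2) ^ 2 + 96 * Cmod tau) * qterm k * qterm (S i).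
Proof.
intros hr hm ht hN hkj.
set (A := 2 * Cmod ((1 - tau) / 2) ^ 2 + 96 * Cmod tau) in *.
assert (hA : 0 < A) by (assert (h := pow2_ge_0 (Cmod ((1 - tau) / 2))); unfold A; lra).
assert (ht0 := Im_pos_neq_0 tau ht).
rewrite lattice_orbit_S.
replace (2 / tau)%C with (2 * / tau)%C by easy.
rewrite <- Cmult_assoc, <- Cmult_plus_distr_l, pm_sum_plus_scal, Cmod_mult.
rewrite Cmod_R, Rabs_pos_eq by lra.
set (S2 := INR k ^ 2 + INR (S i) ^ 2).
assert (hi : 1 <= INR (S i)) by (rewrite S_INR; assert (h := pos_INR i); lra).
assert (hk := pos_INR k).
assert (hS : INR N <= S2).
{ assert (h1 : INR N <= INR N ^ 2).
  { destruct N as [|N]; [simpl; lra|]. rewrite S_INR. assert (h := pos_INR N). nra. }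
  destruct hkj as [h|h]; apply le_INR in h; assert (h0 := pos_INR N); unfold S2; nra. }
assert (key : forall m : Z, IZR m ^ 2 = INR k ^ 2 ->
  Cmod (lattice_term tau m (Z.of_nat (S i)) + / tau * strip_diff tau m (S i))
    <= A * (4 * / S2 ^ 2)).
{ intros m em.
  set (z := (IZR m + INR (S i) * tau)%C).
  assert (hz := lattice_norm_ge tau (IZR m) (INR (S i)) hr hm).
  fold z in hz. rewrite em in hz. fold S2 in hz.
  assert (iz : Im tau <= Im z).
  { replace (Im z) with (INR (S i) * Im tau) by (unfold z, Im; simpl; ring). nra. }
  assert (hS1 : 1 <= S2) by (unfold S2; nra).
  replace (lattice_term tau m (Z.of_nat (S i))) with (/ z ^ 2)%C.
  2:{ unfold lattice_term. rewrite Bool.andb_false_r.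
      unfold z. now rewrite INR_IZR_INZ. }
  eapply Rle_trans; [apply (strip_cell tau z); [easy|easy|lra]|].
  fold A. unfold Rdiv. apply Rmult_le_compat_l; [lra|].
  replace (4 * / S2 ^ 2) with (/ (S2 / 2) ^ 2) by (field; lra).
  apply Rinv_le_contravar; [apply pow_lt; lra|]. apply pow_incr. lra. }
assert (hq := inv_quartic_le k (S i) ltac:(right; lia)). fold S2 in hq.
eapply Rle_trans.
- apply Rmult_le_compat_l; [lra|]. apply (pm_sum_bound _ k (A * (4 * / S2 ^ 2))); apply key.
  + now rewrite <- INR_IZR_INZ.
  + rewrite opp_IZR, <- INR_IZR_INZ. ring.
- assert (h := Rmult_le_compat_l (16 * A) _ _ ltac:(lra) hq). lra.
Qed.

(** * Splitting of the partial sums and passage to the limit *)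

Lemma E2_partial_split (alpha : R) (tau : C) (K : nat) : 0 < Im tau ->
  let M := Z.to_nat (Zfloor (alpha * INR K)) in
  E2_partial alpha tau K
    = (dsum (fun k j => (lattice_orbit tau k j
         + 2 / tau * pm_sum (fun m => strip_diff tau m j) k)%C) M K
       + - (2 / tau) * (log_ratio (((INR K + 1 / 2) / (INR M + 1 / 2))%R * tau)
           + - (1) * log_ratio (((1 / 2) / (INR M + 1 / 2))%R * tau)))%C.
Proof.
intros ht M. rewrite dsum_lin, dsum_strip_diff by easy.
replace (E2_partial alpha tau K) with (dsum (lattice_orbit tau) M K).
- ring.
- unfold E2_partial. fold M. symmetry. unfold lattice_orbit.
  rewrite <- (sum_abs_le_dsum (fun m => pm_sum (lattice_term tau m))).
  apply sum_n_ext. intros k. apply sum_abs_le_pm_sum.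
Qed.

Lemma filterlim_floor (alpha : R) : 0 < alpha ->
  filterlim (fun K => Z.to_nat (Zfloor (alpha * INR K))) eventually eventually.
Proof.
intros ha P [N hN].
destruct (nfloor_ex (INR N / alpha)) as [K0 [_ hK0]].
{ apply Rmult_le_pos; [apply pos_INR|]. left; now apply Rinv_0_lt_compat. }
exists (S K0). intros K hK. apply hN.
apply le_INR in hK. rewrite S_INR in hK.
assert (h : (Z.of_nat N <= Zfloor (alpha * INR K))%Z); [|lia].
apply Zfloor_lub. rewrite <- INR_IZR_INZ.
replace (INR N) with (alpha * (INR N / alpha)) by (field; lra).
apply Rmult_le_compat_l; lra.
Qed.

Lemma filterlim_of_rate (phi : nat -> nat) (u : nat -> R) (l c : R) :
  filterlim phi eventually eventually ->
  (forall K, Rabs (u K - l) <= c / (INR (phi K) + 1 / 2)) ->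
  filterlim u eventually (locally l).
Proof.
intros hphi hu P [eps hP].
destruct (nfloor_ex (Rabs (c / eps)) (Rabs_pos _)) as [N [_ hN]].
apply (filter_imp (F := eventually) (fun K => (S N <= phi K)%nat)).
2: exact (hphi (fun n => (S N <= n)%nat) (ex_intro _ (S N) (fun n h => h))).
intros K hK. apply hP.
change (Rabs (u K - l) < eps).
eapply Rle_lt_trans; [apply hu|].
apply le_INR in hK. rewrite S_INR in hK.
assert (he := cond_pos eps). assert (hp := pos_INR N).
apply Rmult_lt_reg_r with (INR (phi K) + 1 / 2); [lra|].
unfold Rdiv at 1. rewrite Rmult_assoc, Rinv_l, Rmult_1_r by lra.
assert (c / eps < INR (phi K) + 1 / 2) by (assert (h := Rle_abs (c / eps)); lra).
replace c with (eps * (c / eps)) by (field; lra). nra.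
Qed.

(** The numerator alpha (K + 1/2) - (M + 1/2) equals (alpha K - M) + (alpha - 1)/2 with 0 <= alpha K
    - M < 1, so its modulus is at most (1 + alpha)/2. *)
Lemma floor_ratio_rate (alpha : R) (K : nat) : 0 < alpha ->
  let M := Z.to_nat (Zfloor (alpha * INR K)) in
  Rabs ((INR K + 1 / 2) / (INR M + 1 / 2) - / alpha)
    <= ((1 / 2 + alpha / 2) / alpha) / (INR M + 1 / 2).
Proof.
intros ha M.
assert (hb := Zfloor_bound (alpha * INR K)).
assert (hK := pos_INR K).
assert (h0 : (0 <= Zfloor (alpha * INR K))%Z).
{ apply Zfloor_lub. now apply Rmult_le_pos; [left|]. }
assert (eM : INR M = IZR (Zfloor (alpha * INR K))).
{ unfold M. rewrite INR_IZR_INZ. now rewrite Z2Nat.id. }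
rewrite <- eM in hb.
assert (hM := pos_INR M).
replace ((INR K + 1 / 2) / (INR M + 1 / 2) - / alpha)
  with ((alpha * (INR K + 1 / 2) - (INR M + 1 / 2)) / alpha / (INR M + 1 / 2))
  by (field; lra).
assert (hd : forall x y : R, Rabs x <= y ->
  Rabs (x / alpha / (INR M + 1 / 2)) <= y / alpha / (INR M + 1 / 2)).
{ intros x y hxy. unfold Rdiv. rewrite !Rabs_mult.
  rewrite (Rabs_pos_eq (/ alpha)) by (left; now apply Rinv_0_lt_compat).
  rewrite (Rabs_pos_eq (/ (_ + _))) by (left; apply Rinv_0_lt_compat; lra).
  apply Rmult_le_compat_r; [left; apply Rinv_0_lt_compat; lra|].
  apply Rmult_le_compat_r; [left; now apply Rinv_0_lt_compat|easy]. }
apply hd, Rabs_le. lra.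
Qed.

Theorem theorem8 (tau : C)
    (hRe_gt : - (1 / 2) < Re tau) (hRe_le : Re tau <= 1 / 2)
    (hIm : 0 < Im tau) (hmod : 1 <= Cmod tau)
    (hcircle : Cmod tau = 1 -> 0 <= Re tau) :
  exists E : R -> C,
    (forall alpha : R, 0 < alpha -> is_E2 alpha tau (E alpha)) /\
    (forall alpha : R, 0 < alpha ->
       E alpha =
       (E 1%R
        + - (4 * Ci / tau)
          * (Catan (Ci * tau) - Catan (Ci * tau / alpha)))%C).
Proof.
assert (hr : Rabs (Re tau) <= 1 / 2) by (apply Rabs_le; lra).
destruct (nfloor_ex (8 * Cmod tau + 4 * Cmod ((1 - tau) / 2) ^ 2)) as [N0 [_ hN0]].
{ assert (h := pow2_ge_0 (Cmod ((1 - tau) / 2))). lra. }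
set (A := 576 * (2 * Cmod ((1 - tau) / 2) ^ 2 + 96 * Cmod tau)).
destruct (dsum_converges_cofinite
  (fun k j => (lattice_orbit tau k j
     + 2 / tau * pm_sum (fun m => strip_diff tau m j) k)%C)
  (* The constant 24 serves the uncorrected row j = 0 and [A] the other rows; [N0] makes the
     threshold of the cell estimate hold off a finite block. *)
  (Rmax 24 A) (S N0)) as [L hL].
{ intros k j hkj.
  assert (hp : 0 < qterm k * qterm j)
    by (apply Rmult_lt_0_compat; apply qterm_pos).
  rewrite Rmult_assoc.
  destruct j as [|i].
  - apply Rle_trans with (24 * (qterm k * qterm 0));
      [|apply Rmult_le_compat_r; [lra|apply Rmax_l]].
    rewrite <- Rmult_assoc.
    replace (lattice_orbit tau k 0 + _)%C with (lattice_orbit tau k 0)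
      by (destruct k; unfold pm_sum, strip_diff; ring).
    apply lattice_orbit_0_bound.
  - apply Rle_trans with (A * (qterm k * qterm (S i)));
      [|apply Rmult_le_compat_r; [lra|apply Rmax_r]].
    rewrite <- Rmult_assoc.
    apply lattice_orbit_S_bound with (N := S N0); try easy.
    rewrite S_INR. lra. }
(* Only the corner ratio 1/alpha depends on alpha; [L] and the term at 0 cancel in the comparison
   with alpha = 1. *)
exists (fun alpha => (L + - (2 / tau) * (log_ratio ((/ alpha)%R * tau)
  + - (1) * log_ratio (0 * tau)))%C).
split; intros alpha ha.
- assert (hM := filterlim_floor alpha ha).
  unfold is_E2.
  apply (filterlim_ext (fun K => _) _ (fun K => eq_sym (E2_partial_split alpha tau K hIm))).
  apply filterlim_C_plus.
  (* The two-parameter limit is restricted to the path M = floor (alpha K). *)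
  + exact (filterlim_comp_2 _ _ (dsum _) hM (filterlim_id _ _) hL).
  + apply filterlim_C_scal, filterlim_C_plus; [|apply filterlim_C_scal];
      apply filterlim_log_ratio; try easy; try lra.
    * left; now apply Rinv_0_lt_compat.
    * apply (filterlim_of_rate _ _ _ ((1 / 2 + alpha / 2) / alpha) hM). intros K. now apply floor_ratio_rate.
    * apply (filterlim_of_rate _ _ _ (1 / 2) hM). intros K.
      rewrite Rminus_0_r, Rabs_pos_eq; [lra|].
      apply Rmult_le_pos; [lra|]. left; apply Rinv_0_lt_compat.
      assert (h := pos_INR (Z.to_nat (Zfloor (alpha * INR K)))). lra.
- assert (ht0 := Im_pos_neq_0 tau hIm).
  assert (ha0 : RtoC alpha <> 0%C) by (apply RtoC_neq_0; lra).
  replace (Ci * tau / alpha)%C with (Ci * ((/ alpha)%R * tau))%C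
    by (rewrite RtoC_inv by lra; field; easy).
  rewrite !Catan_log_ratio.
  replace ((/ 1)%R * tau)%C with tau by (rewrite Rinv_1; ring).
  field. repeat split; try easy; apply Ci_neq_0.
Qed.
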